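(* Let $H$ be a complex Hilbert space and let $P$, $P'$, $S$ be projections in $H$. Put $R:=P-S$ and $R':=P'-S$. If $$\|R\|_C^2+\|R'\|_C^2<1,$$ then $(P,P')$ is a Fredholm pair and $$\operatorname{ind}(P,P')=\operatorname{ind}(P,S)+\operatorname{ind}(S,P').$$
   Context: ''Projection'' means orthogonal projection onto a closed subspace of $H$. For a bounded operator $T$ on $H$, $\|T\|_C:=\inf\{\|T+K\| : K \text{ compact on } H\}$ is the norm of the class of $T$ in the Calkin algebra of $H$. A pair $(P,Q)$ of projections in $H$ is a Fredholm pair if the restricted operator $Q|_{\operatorname{Ran}(P)}:\operatorname{Ran}(P)\to\operatorname{Ran}(Q)$ is a Fredholm operator, and $\operatorname{ind}(P,Q)$ denotes the index ($\dim\ker-\dim\operatorname{coker}$) of this operator. It is known that $(P,Q)$ is a Fredholm pair if and only if $\|P-Q\|_C<1$. *)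

(* Defs.v *)
From HB Require Import structures.
From mathcomp Require Import all_boot all_order all_algebra.
From mathcomp Require Import complex.
From mathcomp Require Import all_classical all_reals all_analysis.

Set Implicit Arguments.
Unset Strict Implicit.
Unset Printing Implicit Defensive.

Import Order.TTheory GRing.Theory Num.Theory.
Import numFieldNormedType.Exports.

Local Open Scope classical_set_scope.
Local Open Scope ring_scope.
Local Open Scope complex_scope.

Section Operators.
Variables (R : realType) (H : completeNormedModType R[i]).

Definition unit_ball : set H := [set x | `|x| <= 1].

(* Norms of vectors live in R[i] (with zero imaginary part); operator norms
   are taken in R, where suprema and infima are available.  The supremum is
   only meaningful for bounded T. *)
Definition op_norm (T : H -> H) : R :=
  sup [set complex.Re `|T x| | x in unit_ball].

Definition compact_operator (K : {linear H -> H}) : Prop :=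
  continuous K /\ precompact (K @` unit_ball).

Definition calkin_norm (T : {linear H -> H}) : R :=
  inf [set op_norm (T \+ K) | K in compact_operator].

Definition orthogonal_projection (dot : {dot H for Num.conj})
    (P : {linear H -> H}) : Prop :=
  exists M : set H,
    [/\ GRing.submod_closed (mem M), closed M &
        forall x, M (P x) /\ (forall y, M y -> dot (x - P x) y = 0)].

(* For subspaces W `<=` V of H: the classes of e_0, ..., e_(n-1) form a basis
   of the quotient V / W. *)
Definition quotient_basis (V W : set H) (n : nat) (e : 'I_n -> H) : Prop :=
  [/\ forall i, V (e i),
      forall a : 'I_n -> R[i], W (\sum_i a i *: e i) -> forall i, a i = 0 &
      forall x, V x -> exists a : 'I_n -> R[i], W (x - \sum_i a i *: e i)].

Definition has_qdim (V W : set H) (n : nat) : Prop :=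
  exists e : 'I_n -> H, quotient_basis V W e.

Definition finite_qdim (V W : set H) : Prop := exists n, has_qdim V W n.

(* The dimension of V / W, with junk value 0 when it is infinite. *)
Definition qdim (V W : set H) : nat := xget 0%N (has_qdim V W).

Definition ker_on (T : H -> H) (U : set H) : set H := U `&` T @^-1` [set 0].

(* T, restricted to U and viewed as an operator U -> V, is Fredholm; the
   cokernel is V / T(U). *)
Definition fredholm_on (T : {linear H -> H}) (U V : set H) : Prop :=
  [/\ T @` U `<=` V, finite_qdim (ker_on T U) [set 0],
      closed (T @` U) & finite_qdim V (T @` U)].

Definition index_on (T : {linear H -> H}) (U V : set H) : int :=
  (qdim (ker_on T U) [set 0])%:Z - (qdim V (T @` U))%:Z.

Definition fredholm_pair (P Q : {linear H -> H}) : Prop :=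
  fredholm_on Q (range P) (range Q).

Definition ind (P Q : {linear H -> H}) : int :=
  index_on Q (range P) (range Q).

End Operators.

(* Main.v *)
Require Import Defs.
From HB Require Import structures.
From mathcomp Require Import all_boot all_order all_algebra.
From mathcomp Require Import complex.
From mathcomp Require Import ring lra.
From mathcomp Require Import all_classical all_reals all_analysis.

Set Implicit Arguments.
Unset Strict Implicit.
Unset Printing Implicit Defensive.

Import Order.TTheory GRing.Theory Num.Theory.
Import numFieldNormedType.Exports.

Local Open Scope classical_set_scope.
Local Open Scope ring_scope.
Local Open Scope complex_scope.

(** Compactness enters only once, through [calkin_norm_lt]: if the Calkin norm
    of [T] is below [r], then [T] has norm at most [r] on a closed subspace of
    finite codimension.  Choose [r] and [r'] above the Calkin norms of [P - S]
    and [P' - S] with [r^2 + r'^2 < 1], and let [V] be the set of those [v] in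
    the range of [P] for which the bound by [r] applies to [v] and the bound by
    [r'] applies to both [S v] and [v - S v].  It is closed and has finite
    codimension in the range of [P].

    On [V] there are two maps into the range of [P']: the composite [P' S], and
    [P'] itself.  They differ by [P' (1 - S)].  For [v] in [V], Pythagoras gives
<<
      |v - S v|^2        <= r^2 |v|^2,
      |P' (S v)|^2       >= (1 - r'^2) |S v|^2,
      |P' (v - S v)|^2   <= r'^2 |v - S v|^2,
>>
    and adding up, with [|v|^2 = |S v|^2 + |v - S v|^2],
<<
      |P' (S v)|^2 - |P' (v - S v)|^2 >= (1 - r^2 - r'^2) |v|^2.
>>
    This inequality ([perturbation_gap]) is where the hypothesis is used.  It
    makes [P'] bounded below on [V]; it also forbids [P' (S v)] and [P' v] to be
    orthogonal unless [v = 0], because orthogonality would give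
    [|P' (v - S v)|^2 = |P' (S v)|^2 + |P' v|^2].  Consequently neither of the
    subspaces [P' (S V)] and [P' V] contains a nonzero vector orthogonal to the
    other one, so that they have the same codimension in the range of [P']
    ([has_qdim_eq_of_orthogonal]).  This replaces the homotopy from [P' S] to
    [P'] and the local constancy of the index.

    The rest is counting.  If [T : M -> N] is injective on [V] and [T V] has an
    orthogonal complement, then [T] is Fredholm of index
    [dim M / V - dim N / T V] ([fredholm_on_of_injective]).  Applied to
    [S] on [V], to [P'] on [S V] and to [P'] on [V], this expresses the three
    indices by four dimensions, two of which agree by the above, and the sum
    telescopes.  Orthogonal complements exist because the image of a closed
    subspace under an operator that is bounded below on it admits nearest points
    ([complemented_image]). *)

(** * Dimensions of quotients *)

Section QuotientDimension.
Variables (R : realType) (H : completeNormedModType R[i]).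
Implicit Types (U V W M N : set H).

Definition subspace V : Prop :=
  V 0 /\ forall (a : R[i]) x y, V x -> V y -> V (a *: x + y).

Definition free_mod W n (e : 'I_n -> H) : Prop :=
  forall a : 'I_n -> R[i], W (\sum_i a i *: e i) -> forall i, a i = 0.

Lemma subspaceD V x y : subspace V -> V x -> V y -> V (x + y).
Proof. by case=> _ h Vx Vy; rewrite -[x]scale1r; apply: h. Qed.

Lemma subspaceZ V a x : subspace V -> V x -> V (a *: x).
Proof. by case=> V0 h Vx; rewrite -[_ *: _]addr0; apply: h. Qed.

Lemma subspaceN V x : subspace V -> V x -> V (- x).
Proof. by move=> hV Vx; rewrite -scaleN1r; apply: subspaceZ. Qed.

Lemma subspaceB V x y : subspace V -> V x -> V y -> V (x - y).
Proof. by move=> hV Vx Vy; apply: subspaceD => //; apply: subspaceN. Qed.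

Lemma subspace_sum V n (F : 'I_n -> H) :
  subspace V -> (forall i, V (F i)) -> V (\sum_i F i).
Proof.
move=> hV hF; apply: (big_ind V) => //; first by case: hV.
by move=> x y; apply: subspaceD.
Qed.

Lemma subspace_comb V n (a : 'I_n -> R[i]) (e : 'I_n -> H) :
  subspace V -> (forall i, V (e i)) -> V (\sum_i a i *: e i).
Proof. by move=> hV he; apply: subspace_sum => // i; apply: subspaceZ. Qed.

Lemma subspace0 : subspace [set 0].
Proof. by split=> // a x y /= -> ->; rewrite scaler0 addr0. Qed.

Lemma subspaceI V W : subspace V -> subspace W -> subspace (V `&` W).
Proof.
move=> [V0 hV] [W0 hW]; split=> // a x y [Vx Wx] [Vy Wy].
by split; [apply: hV|apply: hW].
Qed.

Lemma subspace_preimage (T : {linear H -> H}) V :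
  subspace V -> subspace (T @^-1` V).
Proof.
move=> [V0 hV]; split=> [|a x y Vx Vy] /=; first by rewrite linear0.
by rewrite linearP; apply: hV.
Qed.

Lemma subspace_image (T : {linear H -> H}) V :
  subspace V -> subspace (T @` V).
Proof.
move=> [V0 hV]; split=> [|a _ _ [x Vx <-] [y Vy <-]].
  by exists 0 => //; rewrite linear0.
by exists (a *: x + y); [apply: hV|rewrite linearP].
Qed.

Lemma subspace_range (T : {linear H -> H}) : subspace (range T).
Proof. by apply: subspace_image. Qed.

Lemma linear_comb (T : {linear H -> H}) n (a : 'I_n -> R[i]) (e : 'I_n -> H) :
  T (\sum_i a i *: e i) = \sum_i a i *: T (e i).
Proof. by rewrite linear_sum; apply: eq_bigr => i _; rewrite linearZ. Qed.

Lemma wide_mx_dependent (F : fieldType) m n (A : 'M[F]_(m, n)) :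
  (n < m)%N -> exists2 v : 'rV_m, v != 0 & v *m A = 0.
Proof.
move=> lt_nm; have kerN0 : kermx A != 0.
  rewrite -mxrank_eq0 mxrank_ker -lt0n subn_gt0.
  exact: leq_ltn_trans (rank_leq_col A) lt_nm.
exists (nz_row (kermx A)); first by rewrite nz_row_eq0.
exact/sub_kermxP/nz_row_sub.
Qed.

(** The exchange argument: with more vectors than coordinates, the coordinate
    matrix has a nonzero row killing it, and the same combination of the [f i]
    then vanishes modulo [W]. *)
Lemma free_mod_bounded W m n (f : 'I_m -> H) (e : 'I_n -> H)
    (A : 'M[R[i]]_(m, n)) :
  subspace W -> (forall i, W (f i - \sum_j A i j *: e j)) ->
  free_mod W f -> (m <= n)%N.
Proof.
move=> hW hA hf; rewrite leqNgt; apply/negP.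
move=> /(wide_mx_dependent A) [v vN0 vA].
case/negP: vN0; apply/eqP/rowP => i; rewrite mxE.
move: i; apply: hf.
have -> : \sum_i0 v 0 i0 *: f i0 =
    \sum_i0 v 0 i0 *: (f i0 - \sum_j A i0 j *: e j).
  apply/esym; under eq_bigr do rewrite scalerBr.
  rewrite sumrB -[RHS]subr0; congr (_ - _).
  under eq_bigr do rewrite scaler_sumr.
  rewrite exchange_big big1 //= => j _.
  under eq_bigr do rewrite scalerA.
  rewrite -scaler_suml (_ : \sum_i0 _ = (v *m A) 0 j); last by rewrite mxE.
  by rewrite vA mxE scale0r.
exact: (subspace_comb _ hW hA).
Qed.

Lemma quotient_basis_bound V W m n (f : 'I_m -> H) (e : 'I_n -> H) :
  subspace W -> quotient_basis V W e -> (forall i, V (f i)) ->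
  free_mod W f -> (m <= n)%N.
Proof.
move=> hW [_ _ he] hf.
have /choice[A hA] i : exists a : 'I_n -> R[i], W (f i - \sum_j a j *: e j).
  exact: he.
apply: (@free_mod_bounded _ _ _ _ e (\matrix_(i, j) A i j)) => // i.
by under eq_bigr do rewrite mxE.
Qed.

Lemma has_qdim_uniq V W m n :
  subspace W -> has_qdim V W m -> has_qdim V W n -> m = n.
Proof.
move=> hW [e he] [f hf]; apply/eqP; rewrite eqn_leq; apply/andP; split.
  by case: he => e1 e2 _; apply: (quotient_basis_bound hW hf e1 e2).
by case: hf => f1 f2 _; apply: (quotient_basis_bound hW he f1 f2).
Qed.

Lemma qdimE V W n : subspace W -> has_qdim V W n -> qdim V W = n.
Proof.
move=> hW hn; apply: (has_qdim_uniq hW _ hn).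
by rewrite /qdim; case: xgetP => [m -> //|/(_ n)].
Qed.

(** A family of maximal length among those free modulo [W] is a basis, since a
    vector outside its span could be added to it. *)
Lemma has_qdim_bounded V W n : subspace W ->
  (forall m (f : 'I_m -> H),
     (forall i, V (f i)) -> free_mod W f -> (m <= n)%N) ->
  exists2 k, (k <= n)%N & has_qdim V W k.
Proof.
move=> hW hn.
pose P m := `[< exists f : 'I_m -> H, (forall i, V (f i)) /\ free_mod W f >].
have P0 : exists m, P m.
  by exists 0%N; apply/asboolP; exists (fun=> 0); split=> [[]|a _ []].
have Pn m : P m -> (m <= n)%N by move=> /asboolP[f [f1 f2]]; apply: hn f1 f2.
case: (ex_maxnP P0 Pn) => k /asboolP[f [Vf free_f]] kmax.
exists k; first by apply: Pn; apply/asboolP; exists f.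
exists f; split=> // x Vx; apply: contrapT => nspan.
suff /kmax : P k.+1 by rewrite ltnn.
apply/asboolP; exists (fun i => oapp f x (unlift ord0 i)); split.
  by move=> i; case: unliftP => [j _|_] //=; apply: Vf.
move=> a; rewrite big_ord_recl unlift_none /=.
under eq_bigr do rewrite liftK /=.
have [a0 | a0N0] := eqVneq (a ord0) 0.
  rewrite a0 scale0r add0r => /(free_f (a \o lift ord0)) ha i.
  by case: (unliftP ord0 i) => [j ->|->//]; apply: ha.
(* The coefficient of [x] is nonzero, so the relation expresses [x] by [f]. *)
move=> Wsum; case: nspan; exists (fun i => - ((a ord0)^-1 * a (lift ord0 i))).
suff -> : x - \sum_i - ((a ord0)^-1 * a (lift ord0 i)) *: f i =
    (a ord0)^-1 *: (a ord0 *: x + \sum_(i < k) a (lift ord0 i) *: f i).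
  exact: subspaceZ.
rewrite scalerDr scalerA mulVf // scale1r scaler_sumr -sumrN; congr (_ + _).
by apply: eq_bigr => i _; rewrite scaleNr opprK scalerA.
Qed.

(** [phi] is meant to induce an injection of [V' / W'] into [V / W].  It need not
    be linear: only combinations of its values are compared, so that it may be
    obtained by choosing representatives. *)
Lemma has_qdim_transfer V W V' W' n (phi : H -> H) :
  subspace W -> subspace W' -> has_qdim V W n ->
  (forall x, V' x -> V (phi x)) ->
  (forall m (a : 'I_m -> R[i]) (x : 'I_m -> H), (forall i, V' (x i)) ->
     W (\sum_i a i *: phi (x i)) -> W' (\sum_i a i *: x i)) ->
  exists2 k, (k <= n)%N & has_qdim V' W' k.
Proof.
move=> hW hW' [e he] phiV phiW; apply: has_qdim_bounded => // m f V'f free_f.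
apply: (quotient_basis_bound hW he (f := phi \o f)) => [i|a /= Wa].
  exact: phiV.
exact/free_f/phiW.
Qed.

Lemma has_qdim_add U V W m n : subspace U -> W `<=` U -> U `<=` V ->
  has_qdim V U m -> has_qdim U W n -> has_qdim V W (m + n).
Proof.
move=> hU WU UV [e [Ve free_e span_e]] [f [Uf free_f span_f]].
pose g i := match fintype.split i with inl j => e j | inr j => f j end.
have gE (a : 'I_(m + n) -> R[i]) : \sum_i a i *: g i =
    \sum_i a (lshift n i) *: e i + \sum_i a (rshift m i) *: f i.
  rewrite big_split_ord /=; congr (_ + _); apply: eq_bigr => i _.
    by rewrite /g (unsplitK (inl i)).
  by rewrite /g (unsplitK (inr i)).
exists g; split.
- by move=> i; rewrite /g; case: fintype.split => j; [apply: Ve|apply/UV/Uf].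
- move=> a; rewrite gE => Wa.
  have ae : forall i, a (lshift n i) = 0.
    apply: free_e; rewrite -[X in U X](addrK (\sum_i a (rshift m i) *: f i)).
    by apply: subspaceB => //; [apply: WU|apply: subspace_comb].
  have af : forall i, a (rshift m i) = 0.
    apply: free_f; move: Wa; rewrite big1 ?add0r// => i _.
    by rewrite ae scale0r.
  by move=> i; case: (split_ordP i) => j ->; [apply: ae|apply: af].
- move=> x /span_e[a /span_f[b Wab]].
  exists (fun i => match fintype.split i with inl j => a j | inr j => b j end).
  rewrite gE opprD addrA.
  under eq_bigr do rewrite (unsplitK (inl _)).
  by under [X in _ - X]eq_bigr do rewrite (unsplitK (inr _)).
Qed.

Lemma finite_qdim_transfer V W V' W' (phi : H -> H) :
  subspace W -> subspace W' -> finite_qdim V W ->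
  (forall x, V' x -> V (phi x)) ->
  (forall m (a : 'I_m -> R[i]) (x : 'I_m -> H), (forall i, V' (x i)) ->
     W (\sum_i a i *: phi (x i)) -> W' (\sum_i a i *: x i)) ->
  finite_qdim V' W'.
Proof.
move=> hW hW' [n VWn] phiV phiW.
by have [k _ ?] := has_qdim_transfer hW hW' VWn phiV phiW; exists k.
Qed.

Lemma finite_qdim_setI U V W : subspace U -> subspace W ->
  finite_qdim V W -> finite_qdim (U `&` V) (U `&` W).
Proof.
move=> hU hW VW; apply: (finite_qdim_transfer (phi := id) hW _ VW).
- exact: subspaceI.
- by move=> x [].
- move=> m a x UVx Wx; split=> //; apply: subspace_comb => // i.
  by case: (UVx i).
Qed.

Lemma finite_qdim_trans U V W : subspace U -> W `<=` U -> U `<=` V ->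
  finite_qdim V U -> finite_qdim U W -> finite_qdim V W.
Proof.
by move=> hU WU UV [m ?] [n ?]; exists (m + n)%N; apply: has_qdim_add UV _ _.
Qed.

Lemma finite_codimI V W : subspace V -> subspace W ->
  finite_qdim setT V -> finite_qdim setT W -> finite_qdim setT (V `&` W).
Proof.
move=> hV hW cV cW; apply: (finite_qdim_trans hV) => //.
by have := finite_qdim_setI hV hW cW; rewrite setIT.
Qed.

Lemma finite_codim_preimage (T : {linear H -> H}) W : subspace W ->
  finite_qdim setT W -> finite_qdim setT (T @^-1` W).
Proof.
move=> hW cW; apply: (finite_qdim_transfer (phi := T) hW _ cW) => //.
- exact: subspace_preimage.
- by move=> m a x _; rewrite /preimage /= linear_comb.
Qed.

Lemma finite_qdim_image (T : {linear H -> H}) V W :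
  subspace W -> finite_qdim V W -> finite_qdim (T @` V) (T @` W).
Proof.
move=> hW VW.
have /choice[phi hphi] y : exists x, (T @` V) y -> V x /\ T x = y.
  by have [[x Vx Tx]|nV] := pselect ((T @` V) y); [exists x|exists 0].
apply: (finite_qdim_transfer (phi := phi) hW _ VW).
- exact: subspace_image.
- by move=> x /hphi[].
- move=> m a x TVx Wx; exists (\sum_i a i *: phi (x i)) => //.
  by rewrite linear_comb; apply: eq_bigr => i _; case: (hphi _ (TVx i)) => _ ->.
Qed.

(** Rank-nullity relative to [V]: the subspace [U] of those vectors of [M] whose
    image lies in [T @` V] is the direct sum of [V] and the kernel, and
    [M / U] is isomorphic to [T @` M / T @` V]. *)
Lemma has_qdim_ker_image (T : {linear H -> H}) M V m n :
  subspace V -> V `<=` M -> ker_on T V `<=` [set 0] -> subspace M ->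
  has_qdim (T @` M) (T @` V) m -> has_qdim (ker_on T M) [set 0] n ->
  has_qdim M V (m + n).
Proof.
move=> hV VM injT hM [e [TMe free_e span_e]] ker_n.
pose U := M `&` T @^-1` (T @` V).
have hU : subspace U.
  by apply: subspaceI => //; apply: subspace_preimage; apply: subspace_image.
apply: (@has_qdim_add U) => //.
- by move=> x Vx; split; [apply: VM|exists x].
- by move=> x [].
- have /choice[f hf] i : exists x, M x /\ T x = e i.
    by case: (TMe i) => x Mx Tx; exists x.
  exists f; split=> [i|a [_ /=]|x Mx].
  + by case: (hf i).
  + rewrite linear_comb => Va; apply: free_e.
    by under eq_bigr => i _ do rewrite -(proj2 (hf i)).
  + have [a ha] : exists a : 'I_m -> R[i], (T @` V) (T x - \sum_i a i *: e i).
      by apply: span_e; exists x.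
    exists a; split; last first.
      rewrite /preimage /= linearB linear_comb /=.
      by under eq_bigr => i _ do rewrite (proj2 (hf i)).
    apply: subspaceB => //; apply: subspace_comb => // i.
    by case: (hf i).
- case: ker_n => f [kf free_f span_f].
  exists f; split=> [i|a Va|x [Mx [v Vv Tv]]].
  + case: (kf i) => Mf Tf; split=> //; exists 0; first by case: hV.
    by rewrite linear0; apply: esym.
  + apply: free_f; apply: injT; split=> //.
    rewrite /preimage /= linear_comb big1 // => i _.
    by case: (kf i) => _ /= ->; rewrite scaler0.
  + have [a /= /eqP] : exists a : 'I_n -> R[i],
        [set 0] ((x - v) - \sum_i a i *: f i).
      apply: span_f; split; first by apply: subspaceB => //; apply: VM.
      by rewrite /preimage /= linearB /= Tv subrr.
    by rewrite addrAC subr_eq0 => /eqP xv; exists a; rewrite xv.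
Qed.

End QuotientDimension.

(** * Geometry of the Hilbert space *)

Section HilbertGeometry.
Variables (R : realType) (H : completeNormedModType R[i]).
Variables (dot : {dot H for Num.conj}).
Hypothesis dot_norm : forall x : H, `|x| ^+ 2 = dot x x.
Implicit Types (x y : H) (U V W X Y : set H).

(** Norms are complex numbers with zero imaginary part; inequalities between
    them are handled in the real field. *)
Definition nrm x : R := complex.Re `|x|.

Lemma nrmE x : `|x| = (nrm x)%:C.
Proof. by rewrite RRe_real // normr_real. Qed.

Lemma nrm_ge0 x : 0 <= nrm x.
Proof. by rewrite -ler0c -nrmE normr_ge0. Qed.

Lemma nrm0_eq0 x : nrm x = 0 -> x = 0.
Proof. by move=> x0; apply/eqP; rewrite -normr_eq0 nrmE x0. Qed.

Lemma nrm0 : nrm 0 = 0.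
Proof. by rewrite /nrm normr0. Qed.

Lemma nrmD x y : nrm (x + y) <= nrm x + nrm y.
Proof.
rewrite -lecR -nrmE; have -> : (nrm x + nrm y)%:C = `|x| + `|y|.
  by rewrite !nrmE rmorphD.
exact: ler_normD.
Qed.

Lemma nrmN x : nrm (- x) = nrm x.
Proof. by rewrite /nrm normrN. Qed.

Lemma nrm_distC x y : nrm (x - y) = nrm (y - x).
Proof. by rewrite /nrm distrC. Qed.

Lemma nrmZ (a : R) x : 0 <= a -> nrm (a%:C *: x) = a * nrm x.
Proof.
move=> a0; apply: complexI; rewrite -nrmE normrZ ger0_norm ?ler0c //.
by rewrite nrmE -rmorphM.
Qed.

Lemma real_complex_pos (e : R[i]) : 0 < e -> exists2 r : R, 0 < r & e = r%:C.
Proof.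
move=> e0; exists (complex.Re e); last by rewrite RRe_real // gtr0_real.
by rewrite -ltcR RRe_real // gtr0_real.
Qed.

Lemma dotE x : dot x x = ((nrm x) ^+ 2)%:C.
Proof. by rewrite -dot_norm nrmE -rmorphXn. Qed.

Lemma dotC0 x y : dot x y = 0 -> dot y x = 0.
Proof. by move=> /eqP; rewrite herm_eq0C => /eqP. Qed.

Lemma pythagoras x y : dot x y = 0 ->
  nrm (x + y) ^+ 2 = nrm x ^+ 2 + nrm y ^+ 2.
Proof.
by move=> xy; apply: complexI; rewrite rmorphD /= -!dotE hnormDd.
Qed.

Lemma pythagorasB x y : dot x y = 0 ->
  nrm (x - y) ^+ 2 = nrm x ^+ 2 + nrm y ^+ 2.
Proof.
by move=> xy; apply: complexI; rewrite rmorphD /= -!dotE hnormBd.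
Qed.

Lemma parallelogram x y :
  nrm (x + y) ^+ 2 + nrm (x - y) ^+ 2 = 2 * nrm x ^+ 2 + 2 * nrm y ^+ 2.
Proof.
rewrite !mulr_natl; apply: complexI.
rewrite !(rmorphD, rmorphMn) /= -!dotE dnormD dnormB.
by rewrite addrACA subrr addr0 addrACA.
Qed.

Lemma dot_self_eq0 x : dot x x = 0 -> x = 0.
Proof. by move=> /eqP; rewrite dnorm_eq0 => /eqP. Qed.

Lemma nonexpansive_continuous (T : {linear H -> H}) :
  (forall x, nrm (T x) <= nrm x) -> continuous T.
Proof.
move=> hT x; apply/cvgrPdist_lt => e e0.
apply/nbhs_normP; exists e => //= y; rewrite /ball_ /= => xy.
by rewrite -linearB (le_lt_trans _ xy) // !nrmE lecR.
Qed.

Lemma cauchy_closed V (v : nat -> H) : closed V -> (forall n, V (v n)) ->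
  (forall e : R, 0 < e -> exists k, forall m n,
     (k <= m)%N -> (k <= n)%N -> nrm (v m - v n) < e) ->
  exists2 l, V l & forall e : R, 0 < e -> exists k, forall n,
     (k <= n)%N -> nrm (l - v n) < e.
Proof.
move=> cV Vv hv.
have /cauchy_cvgP/cvg_ex[/= l vl] : cauchy (v @ \oo).
  apply: cauchy_exP => _ /real_complex_pos[e e0 ->].
  have [k hk] := hv _ e0; exists (v k); exists k => // n /= kn.
  by rewrite -ball_normE /= nrmE ltcR hk.
exists l.
  by apply: (closed_cvg V cV _ _ vl); apply: nearW => n; apply: Vv.
move=> e e0; move/cvgrPdist_lt : vl => /(_ e%:C).
rewrite ltcR => /(_ e0)[k _ hk]; exists k => n kn.
by have := hk n kn; rewrite /= nrmE ltcR.
Qed.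

(** Used in place of closedness, to which it is equivalent for subspaces by
    completeness: unlike closedness, it passes to finite extensions by a mere
    computation. *)
Definition complemented X : Prop :=
  forall x, exists2 y, X y & forall z, X z -> dot (x - y) z = 0.

(** If [y] is the projection of a limit point [x] on [X], then by Pythagoras no
    point of [X] is nearer to [x] than [y]; so [x] and [y] coincide. *)
Lemma complemented_closed X : subspace X -> complemented X -> closed X.
Proof.
move=> hX pX x clx; have [y Xy xy] := pX x.
suff -> : x = y by [].
apply/subr0_eq/nrm0_eq0/eqP.
rewrite eq_le nrm_ge0 andbT leNgt; apply/negP => xy0.
have [|z [Xz]] := clx (ball x (nrm (x - y))%:C).
  by apply: nbhsx_ballx; rewrite ltcR.
rewrite -ball_normE /= nrmE ltcR ltNge => /negP; apply.
rewrite -(ler_pXn2r (n := 2)) ?nnegrE ?nrm_ge0 // -[x - z](subrKA y).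
rewrite (@pythagoras (x - y)) ?lerDl ?sqr_ge0 //.
by apply: xy; apply: subspaceB.
Qed.

(** Otherwise subtracting from [u] its component along [z] would shorten it. *)
Lemma orthogonal_of_minimal X u : subspace X ->
  (forall z, X z -> nrm u <= nrm (u - z)) -> forall z, X z -> dot u z = 0.
Proof.
move=> hX umin z Xz; have [->|z0] := eqVneq z 0; first exact: linear0r.
pose a := dot u z / dot z z.
have dz0 : dot z z != 0 by rewrite dnorm_eq0.
have uaz : dot (u - a *: z) (a *: z) = 0.
  by rewrite linearZr_LR linearBl linearZl_LR /= /a divfK // subrr mulr0.
have := umin (a *: z) (subspaceZ a hX Xz).
rewrite -(ler_pXn2r (n := 2)) ?nnegrE ?nrm_ge0 //.
rewrite -{1}[u](subrK (a *: z)) (@pythagoras (u - _)) // gerDl => az0.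
have /eqP : a *: z = 0.
  by apply/nrm0_eq0/eqP; rewrite -sqrf_eq0 eq_le az0 sqr_ge0.
rewrite scaler_eq0 (negPf z0) orbF /a mulf_eq0 invr_eq0 (negPf dz0) orbF.
by move/eqP.
Qed.

(** * Orthogonal complements of images *)

(** The midpoint of [v] and [w] is at distance at least [d] from [x] as well, so
    the parallelogram law leaves little room for [T v - T w]. *)
Lemma near_minimizers_close (T : {linear H -> H}) V x (d e : R) v w :
  subspace V -> 0 <= d -> 0 <= e -> (forall u, V u -> d <= nrm (x - T u)) ->
  V v -> V w -> nrm (x - T v) <= d + e -> nrm (x - T w) <= d + e ->
  nrm (T (v - w)) ^+ 2 <= 4 * e * (2 * d + e).
Proof.
move=> hV d0 e0 dmin Vv Vw hv hw.
have half : x - T v + (x - T w) = 2%:C *: (x - T ((2^-1)%:C *: (v + w))).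
  rewrite linearZ /= scalerBr scalerA -rmorphM /= divff // scale1r.
  by rewrite rmorph_nat scaler_nat mulr2n (linearD T) opprD addrACA.
have dhalf : 2 * d <= nrm (x - T v + (x - T w)).
  rewrite half nrmZ // ler_pM2l //; apply: dmin.
  by apply: subspaceZ => //; apply: subspaceD.
have := parallelogram (x - T v) (x - T w).
have -> : x - T v - (x - T w) = - T (v - w).
  by rewrite (linearB T) !opprB addrC subrKA.
rewrite nrmN => par.
have a0 := nrm_ge0 (x - T v); have b0 := nrm_ge0 (x - T w).
nra.
Qed.

(** A minimizing sequence for the distance from [x] to [T @` V] is the image of a
    sequence in [V]; the lower bound turns the Cauchy property of the images into
    that of the sequence itself, and its limit gives the nearest point. *)
Lemma complemented_image (T : {linear H -> H}) V (c : R) :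
  subspace V -> closed V -> (forall x, nrm (T x) <= nrm x) ->
  0 < c -> (forall v, V v -> c * nrm v <= nrm (T v)) ->
  complemented (T @` V).
Proof.
move=> hV cV Tle c0 Tge x.
pose S := [set nrm (x - T v) | v in V].
have S0 : S !=set0 by exists (nrm (x - T 0)); exists 0 => //; case: hV.
have lbS : has_lbound S by exists 0 => _ [v _ <-]; apply: nrm_ge0.
pose d := inf S.
have d0 : 0 <= d by apply: lb_le_inf => // _ [v _ <-]; apply: nrm_ge0.
have dmin v : V v -> d <= nrm (x - T v).
  by move=> Vv; apply: ge_inf => //; exists v.
have /choice[v hv] n : exists v, V v /\ nrm (x - T v) <= d + n.+1%:R^-1.
  have n0 : 0 < n.+1%:R^-1 :> R by rewrite invr_gt0.
  have [_ [v Vv <-] hv] := inf_adherent n0 (conj S0 lbS).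
  by exists v; split=> //; apply: ltW.
have small (e : R) : 0 < e -> exists k, forall n, (k <= n)%N -> n.+1%:R^-1 < e.
  by move=> e0; have [k _ hk] := near_infty_natSinv_lt (PosNum e0); exists k.
have [|e e0|l Vl hl] := @cauchy_closed V v cV.
- by move=> n; case: (hv n).
(* The bound [4 t (2 d + t)] on the squared distance of images is at most
   [4 t (2 d + 1)] when [t <= 1], and has to stay below [(c e)^2]. *)
- pose e1 := (c * e) ^+ 2 / (4 * (2 * d + 1)).
  have ce0 : 0 < c * e by rewrite mulr_gt0.
  have d1 : 0 < 4 * (2 * d + 1) by lra.
  have e10 : 0 < e1 by rewrite divr_gt0 // exprn_gt0.
  have [k hk] := small (Num.min 1 e1) ltac:(by rewrite lt_min ltr01 e10).
  exists k => m n km kn.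
  have := hk k (leqnn k); rewrite lt_min => /andP[k1 ke1].
  have near p : (k <= p)%N -> nrm (x - T (v p)) <= d + k.+1%:R^-1.
    move=> kp; apply: le_trans (proj2 (hv p)) _.
    by rewrite lerD2l lef_pV2 ?posrE // ler_nat.
  have kinv0 : 0 < k.+1%:R^-1 :> R by rewrite invr_gt0.
  have := near_minimizers_close hV d0 (ltW kinv0) dmin
    (proj1 (hv m)) (proj1 (hv n)) (near _ km) (near _ kn).
  have := Tge _ (subspaceB hV (proj1 (hv m)) (proj1 (hv n))).
  set N := nrm (v m - v n); set M := nrm _ => cNM M2.
  have e1E : e1 * (4 * (2 * d + 1)) = (c * e) ^+ 2 by rewrite divfK // gt_eqF.
  rewrite -(ltr_pM2l c0); apply: le_lt_trans cNM _.
  rewrite -(ltr_pXn2r (n := 2)) ?nnegrE ?nrm_ge0 ?(ltW ce0) //.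
  apply: le_lt_trans M2 _; rewrite -e1E.
  apply: (@le_lt_trans _ _ (k.+1%:R^-1 * (4 * (2 * d + 1)))).
    rewrite [4 * _]mulrC -mulrA ler_pM2l // ler_pM2l // lerD2l; exact: ltW.
  by rewrite ltr_pM2r.
exists (T l); first by exists l.
have dl : nrm (x - T l) <= d.
  suff h (e : R) : 0 < e -> nrm (x - T l) <= d + e.
    by apply/ler_addgt0Pr => e; apply: h.
  move=> e0; have e20 : 0 < e / 2 by rewrite divr_gt0.
  have [k1 hk1] := small _ e20; have [k2 hk2] := hl _ e20.
  have h1 := hk1 _ (leq_maxl k1 k2); have h2 := hk2 _ (leq_maxr k1 k2).
  have h3 := proj2 (hv (maxn k1 k2)).
  have := nrmD (x - T (v (maxn k1 k2))) (T (v (maxn k1 k2)) - T l).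
  rewrite subrKA -linearB => h4; have := Tle (v (maxn k1 k2) - l).
  rewrite (nrm_distC _ l); move: h1 h2 h3 h4; set i := _^-1; lra.
apply: (orthogonal_of_minimal (subspace_image T hV)).
move=> _ [w Vw <-]; apply: le_trans dl _.
by rewrite -addrA -opprD -(linearD T); apply: dmin; apply: subspaceD.
Qed.

(** One Gram-Schmidt step: [e] is replaced by its component [f] orthogonal to
    [X], and the projection on the sum is the sum of the projections. *)
Lemma complemented_line X (e : H) : subspace X -> complemented X ->
  complemented [set x | exists a : R[i], X (x - a *: e)].
Proof.
move=> hX pX x; have [e1 Xe1 he1] := pX e; have [x1 Xx1 hx1] := pX x.
set f := e - e1 in he1.
have [f0|fN0] := eqVneq f 0.
  (* Here [e] lies in [X], and the sum is [X] itself. *)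
  exists x1; first by exists 0; rewrite scale0r subr0.
  move=> z [a Xz]; have -> : z = z - a *: e + a *: e1.
    by rewrite -[e](subrK e1) -/f f0 add0r subrK.
  by rewrite linearDr /= hx1 // linearZr_LR /= hx1 // mulr0 addr0.
have dff : dot f f != 0 by rewrite dnorm_eq0.
pose b := dot x f / dot f f.
exists (x1 + b *: f).
  exists b; rewrite /f scalerBr [b *: e - _]addrC addrA addrK.
  by apply: subspaceB => //; apply: subspaceZ.
have ortX z : X z -> dot (x - (x1 + b *: f)) z = 0.
  move=> Xz; rewrite opprD addrA linearBl /= hx1 // linearZl_LR /= he1 //.
  by rewrite mulr0 subr0.
have ortf : dot (x - (x1 + b *: f)) f = 0.
  rewrite linearBl /= linearDl /= (dotC0 (he1 _ Xx1)) add0r linearZl_LR /=.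
  by rewrite /b divfK // subrr.
move=> z [a Xz]; have -> : z = z - a *: e + a *: e1 + a *: f.
  by rewrite -addrA -scalerDr subrKC subrK.
rewrite linearDr /= linearZr_LR /= ortf mulr0 addr0 ortX //.
by apply: subspaceD => //; apply: subspaceZ.
Qed.

Lemma complemented_adjoin X n (e : 'I_n -> H) : subspace X -> complemented X ->
  complemented [set x | exists a : 'I_n -> R[i], X (x - \sum_i a i *: e i)].
Proof.
move=> hX pX; elim: n e => [|n IHn] e.
  rewrite (_ : [set x | _] = X) //; apply/seteqP; split=> x /=.
    by move=> [a]; rewrite big_ord0 subr0.
  by move=> Xx; exists (fun=> 0); rewrite big_ord0 subr0.
set Y := [set x | exists a : 'I_n -> R[i],
  X (x - \sum_i a i *: e (lift ord0 i))].
have hY : subspace Y.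
  split=> [|c x y [a Xa] [b Xb]].
    exists (fun=> 0); rewrite big1 ?subr0; first by case: hX.
    by move=> i _; rewrite scale0r.
  exists (fun i => c * a i + b i).
  have -> : c *: x + y - \sum_i (c * a i + b i) *: e (lift ord0 i) =
    c *: (x - \sum_i a i *: e (lift ord0 i)) +
    (y - \sum_i b i *: e (lift ord0 i)).
    under eq_bigr do rewrite scalerDl -scalerA.
    by rewrite big_split /= -scaler_sumr scalerBr opprD addrACA.
  by case: hX => _; apply.
have := complemented_line (e ord0) hY (IHn _).
rewrite (_ : [set x | exists a, Y _] =
  [set x | exists a : 'I_n.+1 -> R[i], X (x - \sum_i a i *: e i)]) //.
apply/seteqP; split=> x /=.
  move=> [a0 [a Xa]]; exists (fun i => oapp a a0 (unlift ord0 i)).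
  rewrite big_ord_recl unlift_none /= opprD addrA.
  by under eq_bigr do rewrite liftK /=.
move=> [a]; rewrite big_ord_recl opprD addrA => Xa.
by exists (a ord0); exists (fun i => a (lift ord0 i)).
Qed.

(** Closedness of the image of a Fredholm operator comes from here, the image
    being a finite extension of the image of [V]. *)
Lemma complemented_finite_ext X U : subspace X -> complemented X ->
  subspace U -> X `<=` U -> finite_qdim U X -> complemented U.
Proof.
move=> hX pX hU XU [n [e [Ue _ span_e]]].
rewrite (_ : U = [set x | exists a : 'I_n -> R[i], X (x - \sum_i a i *: e i)]).
  exact: complemented_adjoin.
apply/seteqP; split=> [x /span_e//|x [a /XU Ua]].
rewrite -[x](subrK (\sum_i a i *: e i)).
by apply: subspaceD => //; apply: subspace_comb.
Qed.

(** * Fredholm operators and their index *)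

(** Modulo [Y] every vector of [N] is represented by one orthogonal to [Y], and
    these representatives inject into [N / X], since only [0] lies in [X] and is
    orthogonal to [Y]. *)
Lemma has_qdim_le_of_orthogonal X Y N n :
  subspace X -> subspace Y -> subspace N -> Y `<=` N -> complemented Y ->
  (forall z, X z -> (forall y, Y y -> dot z y = 0) -> z = 0) ->
  has_qdim N X n -> exists2 k, (k <= n)%N & has_qdim N Y k.
Proof.
move=> hX hY hN YN pY XY0 NX.
have /choice[p hp] x : exists y, Y y /\ forall z, Y z -> dot (x - y) z = 0.
  by have [y Yy hy] := pY x; exists y.
have Yp x : Y (p x) by case: (hp x).
apply: (has_qdim_transfer (phi := fun x => x - p x) hX hY NX).
- by move=> x Nx; apply: subspaceB => //; apply: YN.
- move=> m a x Nx Xsum.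
  have /XY0 : X (\sum_i a i *: (x i - p (x i))) by [].
  have -> : \sum_i a i *: x i =
      \sum_i a i *: (x i - p (x i)) + \sum_i a i *: p (x i).
    by rewrite -big_split; apply: eq_bigr => i _; rewrite /= -scalerDr subrK.
  move=> ->; first by rewrite add0r; apply: subspace_comb.
  move=> y Yy; rewrite linear_sumlz big1 // => i _.
  by rewrite linearZl_LR /= (proj2 (hp _)) // mulr0.
Qed.

Lemma has_qdim_eq_of_orthogonal X Y N n :
  subspace X -> subspace Y -> subspace N -> X `<=` N -> Y `<=` N ->
  complemented X -> complemented Y ->
  (forall z, X z -> (forall y, Y y -> dot z y = 0) -> z = 0) ->
  (forall z, Y z -> (forall x, X x -> dot z x = 0) -> z = 0) ->
  has_qdim N X n -> has_qdim N Y n.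
Proof.
move=> hX hY hN XN YN pX pY XY0 YX0 NX.
have [k kn NY] := has_qdim_le_of_orthogonal hX hY hN YN pY XY0 NX.
have [j jk NX'] := has_qdim_le_of_orthogonal hY hX hN XN pX YX0 NY.
have nj := has_qdim_uniq hX NX NX'.
by have -> : n = k by apply/eqP; rewrite eqn_leq kn nj jk.
Qed.

(** The index is read off from [dim M / V = dim ker + dim (T M / T V)] and
    [dim N / T V = dim coker + dim (T M / T V)]. *)
Lemma fredholm_on_of_injective (T : {linear H -> H}) M N V m n :
  subspace M -> subspace N -> subspace V -> V `<=` M -> T @` M `<=` N ->
  ker_on T V `<=` [set 0] -> complemented (T @` V) ->
  has_qdim M V m -> has_qdim N (T @` V) n ->
  fredholm_on T M N /\ index_on T M N = m%:Z - n%:Z.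
Proof.
move=> hM hN hV VM TMN injT pTV MV NTV.
have hTV := subspace_image T hV; have hTM := subspace_image T hM.
have TVM : T @` V `<=` T @` M by move=> _ [x /VM Mx <-]; exists x.
have [k ker_k] : finite_qdim (ker_on T M) [set 0].
  apply: (finite_qdim_transfer (phi := id) hV _ (ex_intro _ m MV)).
  - exact: subspace0.
  - by move=> x [].
  - move=> p a x kx Vx; apply: injT; split=> //.
    rewrite /preimage /= linear_comb big1 // => i _.
    by case: (kx i) => _ /= ->; rewrite scaler0.
have [j im_j] : finite_qdim (T @` M) (T @` V).
  exact: finite_qdim_image (ex_intro _ m MV).
have [i coker_i] : finite_qdim N (T @` M).
  apply: (finite_qdim_transfer (phi := id) hTV hTM (ex_intro _ n NTV)) => //.
  by move=> p a x _ /TVM.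
have mE : m = (j + k)%N.
  exact: has_qdim_uniq MV (has_qdim_ker_image hV VM injT hM im_j ker_k).
have nE : n = (i + j)%N.
  exact: has_qdim_uniq NTV (has_qdim_add hTM TVM TMN coker_i im_j).
split.
  split=> //; [by exists k| |by exists i].
  apply: complemented_closed => //; apply: complemented_finite_ext TVM _ => //.
  by exists j.
rewrite /index_on (qdimE _ ker_k) ?(qdimE _ coker_i) //; last exact: subspace0.
by rewrite mE nE !PoszD; ring.
Qed.

(** * Orthogonal projections *)

(** For a linear map this single identity is equivalent to being an orthogonal
    projection; the range is then its closed subspace of fixed points. *)
Definition projector (P : {linear H -> H}) : Prop :=
  forall x y, dot (x - P x) (P y) = 0.

Lemma orthogonal_projection_projector (P : {linear H -> H}) :
  orthogonal_projection dot P -> projector P.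
Proof. by move=> [M [_ _ hM]] x y; apply: (proj2 (hM x)); case: (hM y). Qed.

Section Projector.
Variables (P : {linear H -> H}) (hP : projector P).

Lemma projectorK x : P (P x) = P x.
Proof.
apply/esym/subr0_eq/dot_self_eq0.
by rewrite -{2}(linearB P) hP.
Qed.

Lemma projector_range x : range P x -> P x = x.
Proof. by move=> [y _ <-]; apply: projectorK. Qed.

Lemma projector_sym x y : dot (P x) y = dot x (P y).
Proof.
rewrite -[y in LHS](subrK (P y)) linearDr /= dotC0 ?add0r; last exact: hP.
by rewrite -[x in RHS](subrK (P x)) linearDl /= hP add0r.
Qed.

Lemma projector_pythagoras x :
  nrm x ^+ 2 = nrm (P x) ^+ 2 + nrm (x - P x) ^+ 2.
Proof. by have := pythagoras (hP x x); rewrite subrK addrC. Qed.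

Lemma projector_le x : nrm (P x) <= nrm x.
Proof.
rewrite -(ler_pXn2r (n := 2)) ?nnegrE ?nrm_ge0 //.
by rewrite (projector_pythagoras x) lerDl sqr_ge0.
Qed.

Lemma projector_continuous : continuous P.
Proof. exact/nonexpansive_continuous/projector_le. Qed.

Lemma complemented_range : complemented (range P).
Proof. by move=> x; exists (P x) => [|_ [y _ <-]]; [exists x|apply: hP]. Qed.

Lemma closed_range : closed (range P).
Proof. exact: complemented_closed (subspace_range P) complemented_range. Qed.

End Projector.

(** * Compactness and the Calkin norm *)

Definition closed_finite_codim W : Prop :=
  [/\ subspace W, closed W & finite_qdim setT W].

Lemma closed_finite_codimT : closed_finite_codim setT.
Proof.
split; [by []|exact: closedT|].
by exists 0%N; exists (fun=> 0); split=> [|a _ []|x _] //; exists (fun=> 0).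
Qed.

Lemma closed_finite_codimI V W : closed_finite_codim V ->
  closed_finite_codim W -> closed_finite_codim (V `&` W).
Proof.
move=> [V1 V2 V3] [W1 W2 W3].
by split; [exact: subspaceI|exact: closedI|exact: finite_codimI].
Qed.

Lemma closed_finite_codim_preimage (T : {linear H -> H}) W : continuous T ->
  closed_finite_codim W -> closed_finite_codim (T @^-1` W).
Proof.
move=> cT [W1 W2 W3]; split; first exact: subspace_preimage.
  by apply: preimage_closed => // x _; apply: cT.
exact: finite_codim_preimage.
Qed.

Lemma closed_finite_codim_orthogonal y :
  closed_finite_codim [set x | dot x y = 0].
Proof.
have sub : subspace [set x | dot x y = 0].
  split=> [|a u v /= hu hv]; first exact: linear0l.
  by rewrite linearDl /= linearZl_LR /= hu hv mulr0 addr0.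
have [->|y0] := eqVneq y 0.
  rewrite (_ : [set x | _] = setT); first exact: closed_finite_codimT.
  by apply/seteqP; split=> // x _; apply: linear0r.
have dyy : dot y y != 0 by rewrite dnorm_eq0.
have res x : dot (x - (dot x y / dot y y) *: y) y = 0.
  by rewrite linearBl linearZl_LR /= divfK // subrr.
split=> //; last first.
  exists 1%N; exists (fun=> y); split=> // [a|x _].
    rewrite big_ord1 /= linearZl_LR => /eqP.
    by rewrite mulf_eq0 (negPf dyy) orbF => /eqP a0 i; rewrite (ord1 i).
  by exists (fun=> dot x y / dot y y); rewrite big_ord1; apply: res.
apply: complemented_closed => // x.
exists (x - (dot x y / dot y y) *: y); first exact: res.
move=> z zy; rewrite opprB addrC subrK linearZl_LR /=.
by rewrite (dotC0 zy) mulr0.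
Qed.

Lemma closed_finite_codim_orthogonal_seq (K : {linear H -> H}) (s : seq H) :
  continuous K ->
  closed_finite_codim [set x | forall y, y \in s -> dot (K x) y = 0].
Proof.
move=> cK; elim: s => [|y s IHs].
  rewrite (_ : [set x | _] = setT); first exact: closed_finite_codimT.
  by apply/seteqP; split.
have := closed_finite_codimI
  (closed_finite_codim_preimage cK (closed_finite_codim_orthogonal y)) IHs.
congr closed_finite_codim; apply/seteqP; split=> x /=.
  by move=> [xy xs] z; rewrite inE => /orP[/eqP ->//|/xs].
by move=> h; split=> [|z zs]; apply: h; rewrite inE ?eqxx ?zs ?orbT.
Qed.

Lemma bounded_on_unit_ball (T : {linear H -> H}) : continuous T ->
  exists B : R, forall x, unit_ball x -> nrm (T x) <= B.
Proof.
move=> /linear_bounded_continuous/bounded_funP/(_ 1)[B hB].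
by exists (complex.Re B) => x /hB; rewrite lecE => /andP[].
Qed.

Lemma compact_operator0 : compact_operator (\0 : {linear H -> H}).
Proof.
split; first by move=> x; apply: cvg_cst.
apply: (@precompact_subset _ _ [set 0]); first by move=> _ [x _ <-].
by apply: compact_precompact; [exact: norm_hausdorff|exact: compact_set1].
Qed.

Lemma precompact_finite_net (A : set H) (e : R) : 0 < e -> precompact A ->
  exists s : seq H, forall x, A x -> exists2 y, y \in s & nrm (x - y) < e.
Proof.
move=> e0; rewrite precompactE compact_cover => cA.
have [||D _ AD] := cA H setT (fun y => ball y e%:C).
- by move=> y _; apply: ball_open; rewrite ltcR.
- by move=> x _; exists x => //; apply: ballxx; rewrite ltcR.
exists (finmap.enum_fset D) => x /subset_closure/AD[y /= yD].
by rewrite -ball_normE /= nrmE ltcR nrm_distC; exists y.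
Qed.

(** Let [K] be compact with [T + K] of norm below [r] by a margin [e], and let [s]
    be a finite [e]-net of the image of the unit ball under [K].  If [K u] is
    orthogonal to [s], then [0] is at least as near to [K u] as any point of [s],
    so that [K u] has norm below [e]: on the vectors with this property [K] is
    negligible. *)
Lemma calkin_norm_lt (T : {linear H -> H}) (r : R) : continuous T ->
  calkin_norm T < r ->
  exists2 W, closed_finite_codim W & forall x, W x -> nrm (T x) <= r * nrm x.
Proof.
move=> cT; rewrite /calkin_norm => /inf_lt[].
  exists (op_norm (T \+ (\0 : {linear H -> H}))); exists \0 => //.
  exact: compact_operator0.
move=> _ [K [cK pK] <-] TKr; pose e := r - op_norm (T \+ K).
have e0 : 0 < e by rewrite subr_gt0.
have [s hs] := precompact_finite_net e0 pK.
exists [set x | forall y, y \in s -> dot (K x) y = 0].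
  exact: closed_finite_codim_orthogonal_seq.
have TKle x : unit_ball x -> nrm (T x + K x) <= op_norm (T \+ K).
  move=> x1; apply: ub_le_sup; last by exists x.
  have [B hB] := bounded_on_unit_ball cT.
  have [C hC] := bounded_on_unit_ball cK.
  exists (B + C) => _ [y y1 <-]; apply: le_trans (nrmD _ _) _.
  by apply: lerD; [apply: hB|apply: hC].
have ball_le u : unit_ball u -> (forall y, y \in s -> dot (K u) y = 0) ->
    nrm (T u) <= r.
  move=> u1 us; have [|y ys Kuy] := hs (K u); first by exists u.
  have Ku : nrm (K u) <= e.
    apply: le_trans (ltW Kuy).
    rewrite -(ler_pXn2r (n := 2)) ?nnegrE ?nrm_ge0 //.
    by rewrite (pythagorasB (us _ ys)) lerDl sqr_ge0.
  have := nrmD (T u + K u) (- K u); rewrite addrK nrmN => h.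
  have := TKle _ u1; rewrite /e in Ku; lra.
move=> x Wx; have [x0|xN0] := eqVneq (nrm x) 0.
  by rewrite (nrm0_eq0 x0) linear0 nrm0 mulr0.
have x0 : 0 < nrm x by rewrite lt_def xN0 nrm_ge0.
have xi0 : 0 <= (nrm x)^-1 by rewrite invr_ge0 nrm_ge0.
rewrite -ler_pdivrMr // mulrC -nrmZ // -linearZ; apply: ball_le.
  by rewrite /unit_ball /= nrmE nrmZ // mulVf.
by move=> y ys; rewrite linearZ /= linearZl_LR /= Wx // mulr0.
Qed.

(** * Pairs of projections that are close on a subspace of finite codimension *)

Section FredholmPair.
Variables (P Q : {linear H -> H}) (hP : projector P) (hQ : projector Q).
Variables (W : set H) (r : R).
Hypothesis hW : closed_finite_codim W.
Hypothesis r0 : 0 <= r.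
Hypothesis r1 : r < 1.
Hypothesis PQle : forall x, W x -> nrm (P x - Q x) <= r * nrm x.

Lemma projector_sqr_ge x : range P x -> W x ->
  (1 - r ^+ 2) * nrm x ^+ 2 <= nrm (Q x) ^+ 2.
Proof.
move=> Px Wx; have := PQle Wx; rewrite (projector_range hP Px) => xQx.
have : nrm (x - Q x) ^+ 2 <= (r * nrm x) ^+ 2.
  by rewrite ler_pXn2r ?nnegrE ?nrm_ge0 // mulr_ge0 // nrm_ge0.
rewrite (projector_pythagoras hQ x) exprMn (projector_pythagoras hQ x); lra.
Qed.

(** The constant is not sharp: the square root of [1 - r ^+ 2] would do, but
    being at most [1] the number is below its own square root. *)
Lemma projector_ge x : range P x -> W x -> (1 - r ^+ 2) * nrm x <= nrm (Q x).
Proof.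
move=> Px Wx; have r2 : 0 <= 1 - r ^+ 2 by rewrite subr_ge0 expr_le1 // ltW.
rewrite -(ler_pXn2r (n := 2)) ?nnegrE ?nrm_ge0 ?mulr_ge0 ?nrm_ge0 //.
apply: le_trans (projector_sqr_ge Px Wx); rewrite exprMn.
rewrite ler_wpM2r ?sqr_ge0 // expr2 ler_piMl //.
by rewrite gerBl sqr_ge0.
Qed.

Lemma projector_lower_const : 0 < 1 - r ^+ 2.
Proof. by rewrite subr_gt0 expr_lt1. Qed.

Lemma ker_on_range (V : set H) :
  V `<=` range P `&` W -> ker_on Q V `<=` [set 0].
Proof.
move=> VPW x [Vx Qx]; have [Px Wx] := VPW _ Vx; apply/nrm0_eq0/eqP.
have := projector_ge Px Wx; rewrite /preimage /= in Qx; rewrite Qx nrm0.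
by rewrite pmulr_rle0 ?projector_lower_const // eq_le nrm_ge0 andbT.
Qed.

Lemma complemented_image_range (V : set H) : subspace V -> closed V ->
  V `<=` range P `&` W -> complemented (Q @` V).
Proof.
move=> hV cV VPW; apply: complemented_image (projector_lower_const) _ => //.
  exact: projector_le.
by move=> v /VPW[Pv Wv]; apply: projector_ge.
Qed.

(** A vector [z] in the range of [Q] that is orthogonal to the image satisfies
    [P z = 0] as soon as [P z] lies in [W]: then [z] is orthogonal to [Q (P z)],
    hence to [P z].  If moreover [z] lies in [W], closeness of [P] and [Q] gives
    [z = 0].  The two conditions on [z] cut out a subspace of finite codimension,
    with which the image is compared. *)
Lemma finite_codim_image_range :
  finite_qdim (range Q) (Q @` (range P `&` W)).
Proof.
case: (hW) => W1 W2 W3; have hV := subspaceI (subspace_range P) W1.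
have cV := closedI (closed_range hP) W2.
have hWP : closed_finite_codim (W `&` P @^-1` W).
  apply: closed_finite_codimI => //.
  by apply: closed_finite_codim_preimage => //; apply: projector_continuous.
case: hWP => WP1 _ WP3.
have [n] := finite_qdim_setI (subspace_range Q) WP1 WP3.
rewrite setIT => RXn.
suff [k _ ?] : exists2 k, (k <= n)%N &
    has_qdim (range Q) (Q @` (range P `&` W)) k.
  by exists k.
apply: has_qdim_le_of_orthogonal RXn; [| | | | |].
- exact: subspaceI (subspace_range Q) WP1.
- exact: subspace_image.
- exact: subspace_range.
- by move=> _ [x _ <-]; exists x.
- exact: complemented_image_range.
- move=> z [Qz [Wz WPz]] zort.
  have Pz0 : P z = 0.
    apply: dot_self_eq0; rewrite (projector_sym hP) (projectorK hP).
    have <- : dot z (Q (P z)) = dot z (P z).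
      by rewrite -(projector_sym hQ) (projector_range hQ Qz).
    by apply: zort; exists (P z) => //; split=> //; exists z.
  have := PQle Wz; rewrite Pz0 (projector_range hQ Qz) sub0r nrmN => zle.
  apply/nrm0_eq0/eqP; rewrite eq_le nrm_ge0 andbT.
  by rewrite -(@pmulr_rle0 _ (1 - r)) ?subr_gt0 // mulrBl mul1r subr_le0.
Qed.

End FredholmPair.

(** * Replacing the composite of two projections by one of them *)

Section Perturbation.
Variables (P P' S : {linear H -> H}).
Hypotheses (hP : projector P) (hP' : projector P') (hS : projector S).
Variables (W W' : set H) (r r' : R).
Hypothesis r0 : 0 <= r.
Hypothesis r0' : 0 <= r'.
Hypothesis rr' : r ^+ 2 + r' ^+ 2 < 1.
Hypothesis hW : closed_finite_codim W.
Hypothesis hW' : closed_finite_codim W'.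
Hypothesis PSle : forall x, W x -> nrm (P x - S x) <= r * nrm x.
Hypothesis PSle' : forall x, W' x -> nrm (P' x - S x) <= r' * nrm x.

(** With [a = |v|^2] and [s = |S v|^2] the left-hand side is bounded through
    [a - s <= r^2 a] by [s - r'^2 a = (1 - r'^2) s - r'^2 (a - s)], which is
    at most the right-hand side. *)
Lemma perturbation_gap v : range P v -> W v -> W' (S v) -> W' (v - S v) ->
  (1 - r ^+ 2 - r' ^+ 2) * nrm v ^+ 2 <=
    nrm (P' (S v)) ^+ 2 - nrm (P' (v - S v)) ^+ 2.
Proof.
move=> Pv Wv WSv WvSv.
have sqr_le (c x y : R) : 0 <= c -> 0 <= x -> 0 <= y ->
    x <= c * y -> x ^+ 2 <= c ^+ 2 * y ^+ 2.
  by move=> c0 x0 y0 xy; rewrite -exprMn ler_pXn2r ?nnegrE ?mulr_ge0.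
have := sqr_le _ _ _ r0 (nrm_ge0 _) (nrm_ge0 _) (PSle Wv).
rewrite (projector_range hP Pv).
have := sqr_le _ _ _ r0' (nrm_ge0 _) (nrm_ge0 _) (PSle' WSv).
rewrite (projectorK hS) nrm_distC.
have := sqr_le _ _ _ r0' (nrm_ge0 _) (nrm_ge0 _) (PSle' WvSv).
rewrite (linearB S) (projectorK hS) subrr subr0.
have := projector_pythagoras hP' (S v); have := projector_pythagoras hS v.
nra.
Qed.

Lemma perturbation_orthogonal v : range P v -> W v -> W' (S v) ->
  W' (v - S v) -> dot (P' (S v)) (P' v) = 0 -> v = 0.
Proof.
move=> Pv Wv WSv WvSv ort; have := perturbation_gap Pv Wv WSv WvSv.
rewrite (linearB P') nrm_distC (pythagorasB ort) => gap.
apply/nrm0_eq0/eqP; rewrite -sqrf_eq0 eq_le sqr_ge0 andbT.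
have gap0 : 0 < 1 - r ^+ 2 - r' ^+ 2.
  by rewrite -addrA -opprD subr_gt0.
rewrite -(pmulr_rle0 _ gap0); apply: le_trans gap _.
by rewrite opprD addrA subrr sub0r oppr_le0 sqr_ge0.
Qed.

(** Factor the difference of squares in [perturbation_gap]: the difference of the
    norms is at most [|P' v|] by the triangle inequality, and their sum is at most
    [2 |v|]. *)
Lemma perturbation_ge v : range P v -> W v -> W' (S v) -> W' (v - S v) ->
  (1 - r ^+ 2 - r' ^+ 2) / 2 * nrm v <= nrm (P' v).
Proof.
move=> Pv Wv WSv WvSv; have := perturbation_gap Pv Wv WSv WvSv.
have := le_trans (projector_le hP' (S v)) (projector_le hS v).
have : nrm (P' (v - S v)) <= nrm v.
  apply: le_trans (projector_le hP' _) _.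
  rewrite -(ler_pXn2r (n := 2)) ?nnegrE ?nrm_ge0 //.
  by rewrite (projector_pythagoras hS v) lerDr sqr_ge0.
have : nrm (P' (S v)) - nrm (P' (v - S v)) <= nrm (P' v).
  have := nrmD (P' v) (- P' (v - S v)).
  rewrite nrmN -(linearB P') subKr; lra.
have := nrm_ge0 (P' v); have := nrm_ge0 (P' (v - S v)).
have := nrm_ge0 (P' (S v)).
have [v0|vN0] := eqVneq (nrm v) 0; first by rewrite v0 mulr0.
have v0 : 0 < nrm v by rewrite lt_def vN0 nrm_ge0.
set t0 := nrm (P' (S v)); set b := nrm _; set t1 := nrm _.
set a := nrm v in v0 *.
move=> t00 b0 t10 t0b ba t0a gap.
rewrite -(ler_pM2r v0); nra.
Qed.

Lemma fredholm_pair_index_add :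
  fredholm_pair P P' /\
  [/\ fredholm_pair P S, fredholm_pair S P' & ind P P' = ind P S + ind S P'].
Proof.
have gap0 : 0 < 1 - r ^+ 2 - r' ^+ 2 by rewrite -addrA -opprD subr_gt0.
have r1 : r < 1.
  rewrite -(expr_lt1 (n := 2)) //; apply: le_lt_trans rr'.
  by rewrite lerDl sqr_ge0.
have r1' : r' < 1.
  rewrite -(expr_lt1 (n := 2)) //; apply: le_lt_trans rr'.
  by rewrite lerDr sqr_ge0.
have cS := projector_continuous hS.
have cSc : continuous (idfun \- S).
  by move=> x; apply: continuousB; [exact: cvg_id|exact: cS].
pose U := W `&` (S @^-1` W' `&` (idfun \- S : {linear H -> H}) @^-1` W').
have hU : closed_finite_codim U.
  by do 2?[apply: closed_finite_codimI => //];
    apply: closed_finite_codim_preimage.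
pose V := range P `&` U; pose L := range S `&` W'.
have VPU : V `<=` range P `&` U by [].
have [sU clU cofU] := hU; have [sW' clW' cofW'] := hW'.
have sP := subspace_range P; have sS := subspace_range S.
have sP' := subspace_range P'.
have sV : subspace V by apply: subspaceI.
have clV : closed V by apply: closedI => //; apply: closed_range.
have sL : subspace L by apply: subspaceI.
have sSV := subspace_image S sV.
have PSleU x : U x -> nrm (P x - S x) <= r * nrm x by move=> [/PSle].
have SPle' x : W' x -> nrm (S x - P' x) <= r' * nrm x.
  by move=> /PSle'; rewrite nrm_distC.
have VP : V `<=` range P by move=> x [].
have SVL : S @` V `<=` L.
  by move=> _ [v [_ [_ [WSv _]]] <-]; split=> //; exists v.
have SVS : S @` V `<=` range S by move=> x /SVL[].
have range_sub (A : {linear H -> H}) B : A @` B `<=` range A.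
  by move=> _ [x _ <-]; exists x.
have kerS := ker_on_range hP hS r0 r1 PSleU VPU.
have pSV := complemented_image_range hP hS r0 r1 PSleU sV clV VPU.
have clSV := complemented_closed sSV pSV.
have kerP'S := ker_on_range hS hP' r0' r1' SPle' SVL.
have pP'SV := complemented_image_range hS hP' r0' r1' SPle' sSV clSV SVL.
have [m PV] : finite_qdim (range P) V.
  by have := finite_qdim_setI sP sU cofU; rewrite setIT.
have SSV : finite_qdim (range S) (S @` V).
  exact: (finite_codim_image_range hP hS hU r0 r1 PSleU).
have [p P'SV] : finite_qdim (range P') (P' @` (S @` V)).
  apply: (@finite_qdim_trans _ _ (P' @` L)) => //.
  - exact: subspace_image.
  - exact: image_subset.
  - exact: range_sub.
  - exact: (finite_codim_image_range hS hP' hW' r0' r1' SPle').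
  - apply: finite_qdim_image => //.
    by apply: (finite_qdim_transfer (phi := id) sSV sSV SSV) => // x [].
case: SSV => n SSV.
have memV v : V v -> [/\ range P v, W v, W' (S v) & W' (v - S v)].
  by move=> [? [? []]].
have ort v : V v -> dot (P' (S v)) (P' v) = 0 -> v = 0.
  by move=> /memV[*]; apply: perturbation_orthogonal.
have kerP' : ker_on P' V `<=` [set 0].
  move=> v [Vv P'v]; apply: ort => //; rewrite /preimage /= in P'v.
  by rewrite P'v linear0r.
have pP'V : complemented (P' @` V).
  apply: (@complemented_image _ _ ((1 - r ^+ 2 - r' ^+ 2) / 2)) => //.
  - exact: projector_le.
  - by rewrite divr_gt0.
  - by move=> v /memV[*]; apply: perturbation_ge.
(* Both images have the same codimension, although only one of them is known
   beforehand to have a finite one. *)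
have P'V : has_qdim (range P') (P' @` V) p.
  apply: has_qdim_eq_of_orthogonal P'SV => //; do ?exact: subspace_image.
    move=> _ [_ [v Vv <-] <-] zort.
    have -> : v = 0 by apply: ort => //; apply: zort; exists v.
    by rewrite !linear0.
  move=> _ [v Vv <-] zort; have -> : v = 0; last by rewrite linear0.
  by apply: ort => //; apply: dotC0; apply: zort; exists (S v) => //; exists v.
have [PS iPS] :=
  fredholm_on_of_injective sP sS sV VP (range_sub S _) kerS pSV PV SSV.
have [SP' iSP'] := fredholm_on_of_injective sS sP' sSV SVS
  (range_sub P' _) kerP'S pP'SV SSV P'SV.
have [PP' iPP'] :=
  fredholm_on_of_injective sP sP' sV VP (range_sub P' _) kerP' pP'V PV P'V.
by split=> //; split=> //; rewrite /ind iPP' iPS iSP' addrA subrK.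
Qed.

End Perturbation.

End HilbertGeometry.

Lemma enlarge_in_unit_disc (R : realType) (a b : R) : a ^+ 2 + b ^+ 2 < 1 ->
  exists r s : R, [/\ 0 <= r, a < r, 0 <= s, b < s & r ^+ 2 + s ^+ 2 < 1].
Proof.
move=> ab1; pose g := (1 - (a ^+ 2 + b ^+ 2)) / 3.
have g0 : 0 < g by rewrite divr_gt0 // subr_gt0.
have larger (c : R) : c < Num.sqrt (c ^+ 2 + g).
  apply: le_lt_trans (ler_norm c) _.
  by rewrite -sqrtr_sqr ltr_sqrt ?ltrDl // ltr_wpDl // sqr_ge0.
exists (Num.sqrt (a ^+ 2 + g)), (Num.sqrt (b ^+ 2 + g)).
split; rewrite ?sqrtr_ge0 ?larger // !sqr_sqrtr ?addr_ge0 ?sqr_ge0 ?(ltW g0) //.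
by rewrite /g; lra.
Qed.

Theorem theorem3p6 (R : realType) (H : completeNormedModType R[i])
    (dot : {dot H for Num.conj}) (hdot : forall x : H, `|x| ^+ 2 = dot x x)
    (P P' S : {linear H -> H})
    (hP : orthogonal_projection dot P)
    (hP' : orthogonal_projection dot P')
    (hS : orthogonal_projection dot S) :
  calkin_norm (P \- S) ^+ 2 + calkin_norm (P' \- S) ^+ 2 < 1 ->
  fredholm_pair P P' /\
  [/\ fredholm_pair P S, fredholm_pair S P' &
      ind P P' = ind P S + ind S P'].
Proof.
move=> /enlarge_in_unit_disc[r [r' [r0 ltr r0' ltr' rr']]].
have {}hP := orthogonal_projection_projector hP.
have {}hP' := orthogonal_projection_projector hP'.
have {}hS := orthogonal_projection_projector hS.
have cB (A B : {linear H -> H}) : projector dot A -> projector dot B ->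
    continuous (A \- B).
  by move=> hA hB x; apply: continuousB; apply: (projector_continuous hdot).
have [W hW PSle] := calkin_norm_lt hdot (cB _ _ hP hS) ltr.
have [W' hW' PSle'] := calkin_norm_lt hdot (cB _ _ hP' hS) ltr'.
exact: (fredholm_pair_index_add hdot hP hP' hS r0 r0' rr' hW hW' PSle PSle').
Qed.
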